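(* The topos $\mathrm{Sh}(\mathbb{Q})$ of sheaves on the space of rational numbers $\mathbb{Q}$ (with its Euclidean topology) is one-dimensional (over $\mathsf{Set}$).
   Context: Dimension of a Grothendieck topos over $\mathsf{Set}$: for a set $A$ (a group if $m\ge1$, abelian if $m\geq 2$), $\mathrm{H}^m(\mathcal{E},A)$ is the cohomology of $\mathcal{E}$ with coefficients in the constant object $A$: global sections for $m=0$, isomorphism classes of $A$-torsors for $m=1$, usual sheaf cohomology for $m\ge2$ (and for $m=1$ with $A$ abelian). Equivalently it is $\pi_0$ of the simplicial set of global sections of an injectively fibrant Eilenberg--Mac Lane object $K(A,m)$ in simplicial objects of $\mathcal{E}$. For $n\ge0$ a geometric morphism $\rho:\mathcal{F}\to\mathcal{E}$ is $n$-pure if for all objects $X$ of $\mathcal{E}$, all $0\leq m\leq n$, and all sets $A$ (groups if $m\ge1$, abelian if $m\ge2$), the pullback map $\mathrm{H}^m(\mathcal{E}/X,A)\to\mathrm{H}^m(\mathcal{F}/\rho^*X,A)$ is bijective; it is $(-1)$-pure if for $m=0$ these maps are injective for all $X$, $A$; every geometric morphism is $(-2)$-pure. A monomorphism $V\hookrightarrow U$ in $\mathcal{E}$ is $n$-pure if $\mathcal{E}/V\to\mathcal{E}/U$ is. The $(n-1)$-pure monomorphisms are the dense monomorphisms of a Lawvere--Tierney topology on $\mathcal{E}$, with subtopos $\mathcal{E}_{\leq n}$ ($n\ge-1$). Put $\mathcal{E}_{<\infty}=\bigcup_n\mathcal{E}_{\leq n}$ (union of subtoposes). $\mathcal{E}$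 is $n$-dimensional if $n$ is the smallest integer $\ge-1$ with $\mathcal{E}_{\leq n}=\mathcal{E}_{<\infty}$. *)

(* Defs.v *)
From mathcomp Require Import all_boot all_order all_algebra.
From mathcomp Require Import boolp classical_sets topology.

Set Implicit Arguments.
Unset Strict Implicit.
Unset Printing Implicit Defensive.

Import numFieldTopology.Exports.

Declare Scope cat_scope.
Local Open Scope cat_scope.

(* The universe of small sets: sheaves take their values in it, and the
   coefficients of cohomology are taken from it. *)
Definition SET := Type.

Record category := Category {
  obj :> Type;
  hom : obj -> obj -> Type;
  idm : forall X, hom X X;
  compm : forall X Y Z, hom Y Z -> hom X Y -> hom X Z;
  comp_idl : forall X Y (f : hom X Y), compm (idm Y) f = f;
  comp_idr : forall X Y (f : hom X Y), compm f (idm X) = f;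
  comp_assoc : forall X Y Z W (h : hom Z W) (g : hom Y Z) (f : hom X Y),
    compm h (compm g f) = compm (compm h g) f }.

Arguments hom {c} X Y.
Arguments idm {c} X.
Arguments compm {c X Y Z} g f.
Notation "g \oc f" := (compm g f) (at level 50, left associativity) : cat_scope.

Record functor (C D : category) := Functor {
  fobj :> C -> D;
  fmap : forall X Y, hom X Y -> hom (fobj X) (fobj Y);
  fmap_id : forall X, fmap (idm X) = idm (fobj X);
  fmap_comp : forall X Y Z (g : hom Y Z) (f : hom X Y),
    fmap (g \oc f) = fmap g \oc fmap f }.

Arguments fmap {C D} f {X Y} _ : rename.

Record nat_trans (C D : category) (F G : functor C D) := NatTrans {
  nt :> forall X, hom (F X) (G X);
  nt_nat : forall X Y (h : hom X Y), nt Y \oc fmap F h = fmap G h \oc nt X }.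

Lemma nat_trans_eq (C D : category) (F G : functor C D) (a b : nat_trans F G) :
  (forall X, a X = b X) -> a = b.
Proof.
case: a b => [a na] [b nb] /= e.
have {e} e : a = b by apply: functional_extensionality_dep.
by subst b; congr NatTrans; exact: Prop_irrelevance.
Qed.

Section FunctorCategory.
Variables C D : category.

Definition nat_id (F : functor C D) : nat_trans F F.
Proof. by exists (fun X => idm (F X)) => X Y h; rewrite comp_idl comp_idr. Defined.

Definition nat_comp (F G H : functor C D) (b : nat_trans G H) (a : nat_trans F G) :
  nat_trans F H.
Proof.
exists (fun X => b X \oc a X) => X Y h.
by rewrite -comp_assoc nt_nat comp_assoc nt_nat comp_assoc.
Defined.

Definition functor_category : category.
Proof.
exists (functor C D) (@nat_trans C D) nat_id nat_comp.
- by move=> F G a; apply: nat_trans_eq => X /=; exact: comp_idl.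
- by move=> F G a; apply: nat_trans_eq => X /=; exact: comp_idr.
- by move=> F G H K c b a; apply: nat_trans_eq => X /=; exact: comp_assoc.
Defined.

End FunctorCategory.

Definition opposite (C : category) : category.
Proof.
exists C (fun X Y => @hom C Y X) (@idm C) (fun X Y Z g f => f \oc g).
- by move=> X Y f; exact: comp_idr.
- by move=> X Y f; exact: comp_idl.
- by move=> X Y Z W h g f; rewrite comp_assoc.
Defined.

Definition full_subcategory (C : category) (P : C -> Prop) : category :=
  @Category {X : C | P X} (fun X Y => hom (sval X) (sval Y))
    (fun X => idm (sval X)) (fun X Y Z g f => g \oc f)
    (fun X Y => @comp_idl C _ _) (fun X Y => @comp_idr C _ _)
    (fun X Y Z W => @comp_assoc C _ _ _ _).

Definition set_category : category :=
  @Category SET (fun A B => A -> B) (fun A x => x) (fun A B C g f x => g (f x))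
    (fun A B f => erefl) (fun A B f => erefl) (fun A B C D h g f => erefl).

Record opens (S : topologicalType) := Opens {
  oset :> set S;
  oset_open : open oset }.

Definition opens_category (S : topologicalType) : category.
Proof.
exists (opens S) (fun U V => (U `<=` V)%classic)
  (fun U x Ux => Ux) (fun U V W VW UV x Ux => VW x (UV x Ux)) => *;
  exact: Prop_irrelevance.
Defined.

Definition presheaves (S : topologicalType) : category :=
  functor_category (opposite (opens_category S)) set_category.

Definition restr (S : topologicalType) (F : presheaves S) (U V : opens S)
    (VU : (V `<=` U)%classic) : (F : functor _ _) U -> (F : functor _ _) V :=
  @fmap _ _ F U V VU.

Definition is_sheaf (S : topologicalType) (F : presheaves S) : Prop :=
  forall (U : opens S) (C : set (opens S)),
  (forall x, oset U x <-> exists2 V, C V & oset V x) ->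
  forall s : (forall V, C V -> (F : functor _ _) V),
  (forall V W (CV : C V) (CW : C W) (Z : opens S)
     (ZV : (Z `<=` V)%classic) (ZW : (Z `<=` W)%classic),
     restr ZV (s V CV) = restr ZW (s W CW)) ->
  exists! t : (F : functor _ _) U,
    forall V (CV : C V) (VU : (V `<=` U)%classic), restr VU t = s V CV.

Definition Sh (S : topologicalType) : category :=
  full_subcategory (@is_sheaf S).

Section Limits.
Variable E : category.

Definition is_mono (X Y : E) (f : hom X Y) : Prop :=
  forall Z (g h : hom Z X), f \oc g = f \oc h -> g = h.

Definition is_epi (X Y : E) (f : hom X Y) : Prop :=
  forall Z (g h : hom Y Z), g \oc f = h \oc f -> g = h.

Definition is_terminal (T : E) : Prop :=
  forall X, exists f : hom X T, forall g : hom X T, g = f.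

Definition is_product (X Y P : E) (p : hom P X) (q : hom P Y) : Prop :=
  forall Z (f : hom Z X) (g : hom Z Y),
  exists! h : hom Z P, p \oc h = f /\ q \oc h = g.

Definition is_pullback (X Y B P : E) (f : hom X B) (g : hom Y B)
    (p : hom P X) (q : hom P Y) : Prop :=
  f \oc p = g \oc q /\
  forall Z (x : hom Z X) (y : hom Z Y), f \oc x = g \oc y ->
  exists! h : hom Z P, p \oc h = x /\ q \oc h = y.

Definition is_coproduct (I : SET) (X : I -> E) (C : E)
    (inj : forall i, hom (X i) C) : Prop :=
  forall Z (f : forall i, hom (X i) Z),
  exists! h : hom C Z, forall i, h \oc inj i = f i.

End Limits.

Section Slice.
Variable E : category.

Record slice_obj (X : E) := SliceObj {
  slice_dom :> E;
  slice_arr : hom slice_dom X }.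

Definition slice_hom (X : E) (Y Z : slice_obj X) :=
  {h : hom Y Z | slice_arr Z \oc h = slice_arr Y}.

Lemma slice_hom_eq (X : E) (Y Z : slice_obj X) (f g : slice_hom Y Z) :
  sval f = sval g -> f = g.
Proof.
case: f g => [f pf] [g pg] /= e; subst g.
by congr exist; exact: Prop_irrelevance.
Qed.

Definition slice_id (X : E) (Y : slice_obj X) : slice_hom Y Y :=
  exist _ (idm (Y : E)) (comp_idr (slice_arr Y)).

Definition slice_comp (X : E) (Y Z W : slice_obj X)
  (g : slice_hom Z W) (f : slice_hom Y Z) : slice_hom Y W.
Proof.
by exists (sval g \oc sval f); rewrite comp_assoc (svalP g) (svalP f).
Defined.

Definition slice (X : E) : category.
Proof.
exists (slice_obj X) (@slice_hom X) (@slice_id X) (@slice_comp X).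
- by move=> Y Z f; apply: slice_hom_eq; exact: comp_idl.
- by move=> Y Z f; apply: slice_hom_eq; exact: comp_idr.
- by move=> Y Z W V h g f; apply: slice_hom_eq; exact: comp_assoc.
Defined.

(* Composition with [m], as a functor E/V -> E/U. *)
Definition slice_sum (V U : E) (m : hom V U) : functor (slice V) (slice U).
Proof.
unshelve refine (@Functor (slice V) (slice U)
  (fun Y => SliceObj (m \oc slice_arr Y))
  (fun Y Z h => exist _ (sval h) _) _ _).
- by rewrite /= -comp_assoc (svalP h).
- by move=> Y; exact: slice_hom_eq.
- by move=> Y Z W g f; exact: slice_hom_eq.
Defined.

End Slice.

Definition slice_functor (E F : category) (f : functor E F) (X : E) :
  functor (slice X) (slice (f X)).
Proof.
unshelve refine (@Functor (slice X) (slice (f X))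
  (fun Y => SliceObj (fmap f (slice_arr Y)))
  (fun Y Z h => exist _ (fmap f (sval h)) _) _ _).
- by rewrite /= -fmap_comp (svalP h).
- by move=> Y; apply: slice_hom_eq; exact: fmap_id.
- by move=> Y Z W g h; apply: slice_hom_eq; exact: fmap_comp.
Defined.

Record adjunction (C D : category) (L : functor C D) (R : functor D C) :=
  Adjunction {
    adj : forall X Y, hom (L X) Y -> hom X (R Y);
    adj_inv : forall X Y, hom X (R Y) -> hom (L X) Y;
    adjK : forall X Y, cancel (@adj X Y) (@adj_inv X Y);
    adj_invK : forall X Y, cancel (@adj_inv X Y) (@adj X Y);
    adj_nat : forall X X' Y Y' (g : hom X' X) (f : hom (L X) Y) (h : hom Y Y'),
      adj (h \oc f \oc fmap L g) = fmap R h \oc adj f \oc g }.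

Definition preserves_finite_limits (C D : category) (f : functor C D) : Prop :=
  (forall T, is_terminal T -> is_terminal (f T)) /\
  (forall X Y B P (a : hom X B) (b : hom Y B) (p : hom P X) (q : hom P Y),
     is_pullback a b p q ->
     is_pullback (fmap f a) (fmap f b) (fmap f p) (fmap f q)).

Record geometric_morphism (F E : category) := GeometricMorphism {
  inverse_image : functor E F;
  direct_image : functor F E;
  geom_adj : adjunction inverse_image direct_image;
  geom_lex : preserves_finite_limits inverse_image }.

(* From here on, categories are meant to be toposes.  The constant object on a set
   [A] is the coproduct of [A] copies of the terminal object. *)

Record constant_object (E : category) (A : SET) := ConstantObject {
  const_pt : E;
  const_ptP : is_terminal const_pt;
  const_obj : E;
  const_in : A -> hom const_pt const_obj;
  const_coproduct : is_coproduct (X := fun _ : A => const_pt) const_in }.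

(* [t] and [c] identify the image under [f] of the terminal object and of the
   constant object on [A] with those of the target.  When [f] is an inverse
   image functor, both exist, are unique, and are isomorphisms. *)
Definition is_comparison (E F : category) (f : functor E F) (A : SET)
    (K : constant_object E A) (K' : constant_object F A)
    (t : hom (const_pt K') (f (const_pt K)))
    (c : hom (f (const_obj K)) (const_obj K')) : Prop :=
  forall a, c \oc fmap f (const_in K a) \oc t = const_in K' a.

(* [g] induces a bijection between the elements of [P] modulo [R] and those of
   [P'] modulo [R'] (for [g] compatible with these data). *)
Definition bijective_on_classes (T T' : Type) (P : T -> Prop)
    (R : T -> T -> Prop) (P' : T' -> Prop) (R' : T' -> T' -> Prop)
    (g : T -> T') : Prop :=
  (forall x y, P x -> P y -> R' (g x) (g y) -> R x y) /\
  (forall y, P' y -> exists x, P x /\ R' (g x) y).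

Definition H0_injective (E F : category) (f : functor E F) (A : SET) : Prop :=
  forall (K : constant_object E A) (K' : constant_object F A) t c,
  is_comparison (K := K) (K' := K') t c ->
  injective (fun s : hom (const_pt K) (const_obj K) => c \oc fmap f s \oc t).

Definition H0_bijective (E F : category) (f : functor E F) (A : SET) : Prop :=
  forall (K : constant_object E A) (K' : constant_object F A) t c,
  is_comparison (K := K) (K' := K') t c ->
  bijective (fun s : hom (const_pt K) (const_obj K) => c \oc fmap f s \oc t).

Section Torsors.
Variables (A : groupType) (E : category).

Record action_obj := ActionObj {
  act_dom :> E;
  act : A -> hom act_dom act_dom;
  act_one : act 1%g = idm act_dom;
  act_mul : forall a b, act (a * b)%g = act a \oc act b }.

(* P -> 1 is an epimorphism and the maps (act a, id) : P -> P x P, for a in A,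
   exhibit P x P as the coproduct of A copies of P. *)
Definition is_torsor (P : action_obj) : Prop :=
  (exists (T : E) (p : hom P T), is_terminal T /\ is_epi p) /\
  (exists (PP : E) (p q : hom PP P) (i : A -> hom P PP),
     [/\ is_product p q,
         forall a, p \oc i a = act P a /\ q \oc i a = idm (P : E) &
         is_coproduct (X := fun _ : A => P : E) i]).

Definition act_iso (P Q : action_obj) : Prop :=
  exists (h : hom P Q) (k : hom Q P),
    [/\ k \oc h = idm (P : E), h \oc k = idm (Q : E) &
        forall a, h \oc act P a = act Q a \oc h].

End Torsors.

Definition act_image (A : groupType) (E F : category) (f : functor E F)
  (P : action_obj A E) : action_obj A F.
Proof.
exists (f P) (fun a => fmap f (act P a)).
- by rewrite act_one fmap_id.
- by move=> a b; rewrite act_mul fmap_comp.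
Defined.

Definition H1_bijective (E F : category) (f : functor E F) (A : groupType) :
    Prop :=
  bijective_on_classes (@is_torsor A E) (@act_iso A E)
    (@is_torsor A F) (@act_iso A F) (act_image f).

(* An abelian group object, given by natural abelian group structures on the
   sets of generalized elements. *)
Record ab_struct (E : category) (M : E) := AbStruct {
  ab_add : forall X, hom X M -> hom X M -> hom X M;
  ab_zero : forall X, hom X M;
  ab_opp : forall X, hom X M -> hom X M;
  ab_addA : forall X, associative (@ab_add X);
  ab_addC : forall X, commutative (@ab_add X);
  ab_add0 : forall X, left_id (ab_zero X) (@ab_add X);
  ab_addN : forall X, left_inverse (ab_zero X) (@ab_opp X) (@ab_add X);
  ab_nat : forall X Y (h : hom Y X) (x y : hom X M),
    ab_add x y \oc h = ab_add (x \oc h) (y \oc h) }.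

Record abgroup (E : category) := AbGroup {
  ab_obj :> E;
  ab_str : ab_struct ab_obj }.

Definition addm (E : category) (M : abgroup E) X (x y : hom X M) : hom X M :=
  ab_add (ab_str M) x y.

Definition zerom (E : category) (M : abgroup E) X : hom X M :=
  ab_zero (ab_str M) X.

Arguments zerom {E M X}.

Section AbelianGroups.
Variable E : category.

Definition is_additive (M N : abgroup E) (h : hom M N) : Prop :=
  forall X (x y : hom X M), h \oc addm x y = addm (h \oc x) (h \oc y).

(* Exactness at N: u lands in the kernel of v, and every generalized element
   of this kernel comes locally, i.e. after an epimorphism, from M. *)
Definition is_exact (M N L : abgroup E) (u : hom M N) (v : hom N L) : Prop :=
  v \oc u = zerom /\
  forall X (y : hom X N), v \oc y = zerom ->
  exists (Y : E) (e : hom Y X) (x : hom Y M), is_epi e /\ u \oc x = y \oc e.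

Definition is_injective (J : abgroup E) : Prop :=
  forall (M N : abgroup E) (i : hom M N) (g : hom M J),
  is_additive i -> is_mono i -> is_additive g ->
  exists2 h : hom N J, is_additive h & h \oc i = g.

Record injective_resolution (M : abgroup E) := InjectiveResolution {
  res : nat -> abgroup E;
  res_aug : hom M (res 0);
  res_d : forall k, hom (res k) (res k.+1);
  res_aug_additive : is_additive res_aug;
  res_d_additive : forall k, is_additive (res_d k);
  res_aug_mono : is_mono res_aug;
  res_exact0 : is_exact res_aug (res_d 0);
  res_exact : forall k, is_exact (res_d k) (res_d k.+1);
  res_injective : forall k, is_injective (res k) }.

Definition is_cocycle (M : abgroup E) (I : injective_resolution M) (k : nat)
    (T : E) (s : hom T (res I k)) : Prop :=
  res_d I k \oc s = zerom.

Definition cohomologous (M : abgroup E) (I : injective_resolution M) (k : nat)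
    (T : E) (s s' : hom T (res I k.+1)) : Prop :=
  exists r : hom T (res I k), s' = addm s (res_d I k \oc r).

Record constant_abgroup (A : zmodType) := ConstantAbgroup {
  cab_const :> constant_object E A;
  cab_str : ab_struct (const_obj cab_const);
  cab_in : forall a b : A, const_in cab_const (a + b)%R =
    ab_add cab_str (const_in cab_const a) (const_in cab_const b) }.

Definition cab_group (A : zmodType) (K : constant_abgroup A) : abgroup E :=
  AbGroup (cab_str K).

End AbelianGroups.

(* [phi] is a map of complexes of abelian group objects from f(I) to J over
   [c].  As [f] preserves products, the sum of f(I k) is the image of that of
   I k, so that additivity may be tested on elements of the form [fmap f x]. *)
Definition is_resolution_map (E F : category) (f : functor E F) (A : zmodType)
    (K : constant_abgroup E A) (K' : constant_abgroup F A)
    (c : hom (f (const_obj K)) (const_obj K'))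
    (I : injective_resolution (cab_group K))
    (J : injective_resolution (cab_group K'))
    (phi : forall k, hom (f (res I k)) (res J k)) : Prop :=
  [/\ forall k X (x y : hom X (res I k)),
        phi k \oc fmap f (addm x y) =
        addm (phi k \oc fmap f x) (phi k \oc fmap f y),
      phi 0 \oc fmap f (res_aug I) = res_aug J \oc c &
      forall k, phi k.+1 \oc fmap f (res_d I k) = res_d J k \oc phi k].

(* Bijectivity on the cohomology, in degree k + 1, of the complexes of global
   sections of injective resolutions of the constant abelian group objects.
   Resolutions and [phi] exist in toposes, and the induced map does not depend
   on them up to canonical isomorphism. *)
Definition HS_bijective (k : nat) (E F : category) (f : functor E F)
    (A : zmodType) : Prop :=
  forall (K : constant_abgroup E A) (K' : constant_abgroup F A) t c,
  is_comparison (K := K) (K' := K') t c ->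
  forall (I : injective_resolution (cab_group K))
         (J : injective_resolution (cab_group K')) phi,
  is_resolution_map c (I := I) (J := J) phi ->
  bijective_on_classes
    (@is_cocycle _ _ I k.+1 (const_pt K)) (@cohomologous _ _ I k (const_pt K))
    (@is_cocycle _ _ J k.+1 (const_pt K')) (@cohomologous _ _ J k (const_pt K'))
    (fun s => phi k.+1 \oc fmap f s \oc t).

Definition H_bijective (m : nat) (E F : category) (f : functor E F) : Prop :=
  match m with
  | 0 => forall A : SET, H0_bijective f A
  | 1 => forall A : groupType, H1_bijective f A
  | k.+2 => forall A : zmodType, HS_bijective k.+1 f A
  end.

(* Only used for n >= -2. *)
Definition is_pure (n : int) (F E : category) (rho : geometric_morphism F E) :
    Prop :=
  match n with
  | Posz k => forall (X : E) (m : nat), m <= k ->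
      H_bijective m (slice_functor (inverse_image rho) X)
  | Negz 0 => forall (X : E) (A : SET),
      H0_injective (slice_functor (inverse_image rho) X) A
  | Negz _ => True
  end.

(* The geometric morphism E/V -> E/U induced by m is the one whose inverse
   image is the pullback along m, i.e. the right adjoint of [slice_sum m]. *)
Definition pure_mono (n : int) (E : category) (V U : E) (m : hom V U) : Prop :=
  is_mono m /\
  exists rho : geometric_morphism (slice V) (slice U),
    inhabited (adjunction (slice_sum m) (inverse_image rho)) /\ is_pure n rho.

Record subobject_classifier (E : category) := SubobjectClassifier {
  omega_pt : E;
  omega_ptP : is_terminal omega_pt;
  omega : E;
  truth : hom omega_pt omega;
  omegaP : forall (V U : E) (m : hom V U), is_mono m ->
    exists! chi : hom U omega,
      exists b : hom V omega_pt, is_pullback chi truth m b }.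

Definition classifies (E : category) (W : subobject_classifier E) (V U : E)
    (m : hom V U) (chi : hom U (omega W)) : Prop :=
  exists b : hom V (omega_pt W), is_pullback chi (truth W) m b.

(* Lawvere--Tierney topologies; [lt_meet] is the meet on Omega, that is the
   classifying map of (true, true) : 1 -> Omega x Omega. *)
Record lt_topology (E : category) := LTTopology {
  lt_class : subobject_classifier E;
  lt_j : hom (omega lt_class) (omega lt_class);
  lt_sq : E;
  lt_p1 : hom lt_sq (omega lt_class);
  lt_p2 : hom lt_sq (omega lt_class);
  lt_sqP : is_product lt_p1 lt_p2;
  lt_tt : hom (omega_pt lt_class) lt_sq;
  lt_tt1 : lt_p1 \oc lt_tt = truth lt_class;
  lt_tt2 : lt_p2 \oc lt_tt = truth lt_class;
  lt_meet : hom lt_sq (omega lt_class);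
  lt_meetP : classifies lt_tt lt_meet;
  lt_jj : hom lt_sq lt_sq;
  lt_jj1 : lt_p1 \oc lt_jj = lt_j \oc lt_p1;
  lt_jj2 : lt_p2 \oc lt_jj = lt_j \oc lt_p2;
  lt_true : lt_j \oc truth lt_class = truth lt_class;
  lt_idem : lt_j \oc lt_j = lt_j;
  lt_meetE : lt_j \oc lt_meet = lt_meet \oc lt_jj }.

(* The closure of m, classified by j o chi, is the whole of U. *)
Definition lt_dense (E : category) (j : lt_topology E) (V U : E)
    (m : hom V U) : Prop :=
  is_mono m /\
  exists chi, classifies m chi /\ classifies (idm U) (lt_j j \oc chi).

(* F is a sheaf for the topology whose dense monomorphisms are given by D. *)
Definition sheaf_for (E : category) (D : forall V U : E, hom V U -> Prop)
    (F : E) : Prop :=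
  forall (V U : E) (m : hom V U), D V U m ->
  forall f : hom V F, exists! g : hom U F, g \oc m = f.

(* A subtopos is identified with its (replete, full) class of objects. *)
Definition is_subtopos (E : category) (P : E -> Prop) : Prop :=
  exists j : lt_topology E, forall F, P F <-> sheaf_for (lt_dense j) F.

Section Dimension.
Variable E : category.
Local Open Scope ring_scope.

(* The subtopos E_{<= n}, for n >= -1. *)
Definition E_le (n : int) (F : E) : Prop :=
  sheaf_for (fun V U (m : hom V U) => pure_mono (n - 1) m) F.

(* The union of the subtoposes E_{<= n}, i.e. the least subtopos containing all
   of them.  An intersection of subtoposes is a subtopos, so this is the
   intersection of the subtoposes containing every E_{<= n}. *)
Definition E_lt_infty (F : E) : Prop :=
  forall P : E -> Prop, is_subtopos P ->
  (forall n : int, -1 <= n -> forall G, E_le n G -> P G) -> P F.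

Definition is_dimensional (n : int) : Prop :=
  [/\ -1 <= n,
      forall F, E_le n F <-> E_lt_infty F &
      forall k : int, -1 <= k -> (forall F, E_le k F <-> E_lt_infty F) -> n <= k].

End Dimension.

(* Main.v *)
From mathcomp Require Import all_boot all_order all_algebra.
From mathcomp Require Import boolp classical_sets topology normedtype.
Require Import Defs.
Import Order.TTheory GRing.Theory Num.Theory.
Import numFieldTopology.Exports.

Set Implicit Arguments.
Unset Strict Implicit.
Unset Printing Implicit Defensive.

Local Open Scope cat_scope.

(** Write [S] for the space of rational numbers; all that matters is that every
    point [x] is the intersection of countably many clopen neighbourhoods
    [N k], and that some proper open subset is dense.

    The theorem reduces to two facts about monomorphisms of sheaves on [S].

    (1) A 0-pure monomorphism [V -> U] is an isomorphism
    ([clopen_points_E_le1]), so that the subtopos [E_le 1] is the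
    whole topos; every later subtopos, and the union, must then agree with it.
    If a section [u] of [U] over [W] does not come from [V] near [x], consider
    the largest open [W'] on which it does, so that [x] is not in [W'].  The
    map sending [y <> x] to the least [k] such that [y] is not in [N k] is
    locally constant on [W'].  Purity in degree 0, applied to the object [u] of
    the slice over [U] and the coefficient set [nat], says that every locally
    constant function [W' -> nat] has exactly one locally constant extension to
    [W].  Let [n] be the value at [x] of the extension of this map.  No point
    of [W'] at which it takes the value [n] is in [N n], so the value may be
    changed from [n] to [n.+1] on [N n] without affecting [W'], which
    contradicts uniqueness ([zero_pure_locally_onto]).

    (2) The inclusion of a dense open [W0] into [S], seen as a monomorphism
    between subterminal sheaves, is (-1)-pure, because locally constant
    functions that agree on a dense subset are equal ([dense_open_pure]).  The
    subterminal sheaf of [W0] is not a sheaf for it: its identity does not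
    extend to a global section.  Hence [E_le 0] and [E_le (-1)] are proper
    ([dense_open_not_E_le]).

    To make purity concrete, both arguments need constant objects in the slices
    of the topos.  The coproduct of [A] copies of a sheaf [X] is the product of
    [X] with the sheaf of locally constant functions to [A]
    ([copower_coproduct]); inverse images preserve it because they have a right
    adjoint, and transposing along their left adjoint, which exists for the
    pullback along a monomorphism, turns degree 0 cohomology into sections
    ([H0_bijective_sections], [H0_injective_sections]).  In (2) one also has to
    exhibit the geometric morphism of slices induced by the inclusion of
    [W0]. *)

(** * Adjunctions and slices *)

Section Adjunctions.
Variables (C D : category) (L : functor C D) (R : functor D C).
Variable a : adjunction L R.

Lemma adj_precomp X X' Y (f : hom (L X) Y) (g : hom X' X) :
  adj a (f \oc fmap L g) = adj a f \oc g.
Proof.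
by have := adj_nat a g f (idm Y); rewrite comp_idl fmap_id comp_idl.
Qed.

Lemma adj_postcomp X Y Y' (h : hom Y Y') (f : hom (L X) Y) :
  adj a (h \oc f) = fmap R h \oc adj a f.
Proof.
by have := adj_nat a (idm X) f h; rewrite fmap_id !comp_idr.
Qed.

Definition counit Y : hom (L (R Y)) Y := adj_inv a (idm (R Y)).

Lemma adj_counit Y : adj a (counit Y) = idm (R Y).
Proof. exact: adj_invK. Qed.

Lemma adj_comp_counit Y Y' (h : hom Y Y') : adj a (h \oc counit Y) = fmap R h.
Proof. by rewrite adj_postcomp adj_counit comp_idr. Qed.

Lemma adj_inj X Y : injective (@adj _ _ _ _ a X Y).
Proof. exact: can_inj (@adjK _ _ _ _ a X Y). Qed.

Lemma adj_inv_precomp X X' Y (f : hom X (R Y)) (g : hom X' X) :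
  adj_inv a (f \oc g) = adj_inv a f \oc fmap L g.
Proof. by apply: adj_inj; rewrite adj_precomp !adj_invK. Qed.

Lemma left_adjoint_coproduct (I : SET) (X : I -> C) (T : C)
    (inj : forall i, hom (X i) T) :
  is_coproduct inj -> is_coproduct (fun i => fmap L (inj i)).
Proof.
move=> cp Z f; have [h [hE hU]] := cp (R Z) (fun i => adj a (f i)).
exists (adj_inv a h); split=> [i|h' h'E].
  by rewrite -adj_inv_precomp hE adjK.
rewrite -[h'](adjK a); congr adj_inv; apply: hU => i.
by rewrite -adj_precomp h'E.
Qed.

Lemma right_adjoint_lex : preserves_finite_limits R.
Proof.
split=> [T Tt X|X Y B P f g p q [sq U]].
  have [t tU] := Tt (L X); exists (adj a t) => g.
  by rewrite -[g](adj_invK a); congr adj; exact: tU.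
split=> [|Z x y xy]; first by rewrite -!fmap_comp sq.
have [|h [[hx hy] hU]] := U _ (adj_inv a x) (adj_inv a y).
  by apply: adj_inj; rewrite !adj_postcomp !adj_invK.
exists (adj a h); split=> [|k [kx ky]].
  by rewrite -!adj_postcomp hx hy !adj_invK.
rewrite -[k](adj_invK a); congr adj; apply: hU.
by rewrite -kx -ky; split; apply: adj_inj; rewrite adj_postcomp !adj_invK.
Qed.

End Adjunctions.

Section SliceConstants.
Variable E : category.

Lemma terminal_uniq (T : E) : is_terminal T ->
  forall X (f g : hom X T), f = g.
Proof. by move=> Tt X f g; have [h hU] := Tt X; rewrite (hU f) (hU g). Qed.

Lemma coproduct_ext (I : SET) (X : I -> E) (C : E)
    (inj : forall i, hom (X i) C) : is_coproduct inj ->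
  forall Z (g h : hom C Z), (forall i, g \oc inj i = h \oc inj i) -> g = h.
Proof.
move=> cp Z g h gh; have [k [_ kU]] := cp Z (fun i => h \oc inj i).
by rewrite -(kU g gh); exact: kU.
Qed.

(** Stated with an equation because the image of the identity under a functor
    is an identity only propositionally. *)
Lemma slice_terminal (X : E) (i : hom X X) :
  i = idm X -> is_terminal (SliceObj i : slice X).
Proof.
move=> -> [Y y]; unshelve eexists (exist _ y _); first exact: comp_idl.
move=> [g gE]; apply: slice_hom_eq => /=; rewrite -[RHS]gE /=.
by rewrite comp_idl.
Qed.

(** A map out of the coproduct lies over [X] as soon as its components do. *)
Lemma slice_coproduct (I : SET) (X : E) (Y : I -> slice X) (T : slice X)
    (inj : forall i, hom (Y i) T) :
  is_coproduct (fun i => sval (inj i)) -> is_coproduct inj.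
Proof.
move=> cp Z f; have [h [hE hU]] := cp Z (fun i => sval (f i)).
unshelve eexists (exist _ h _).
  apply: (coproduct_ext cp) => i; rewrite -comp_assoc hE (svalP (f i)).
  exact/esym/(svalP (inj i)).
split=> [i|[k kP] kE]; apply: slice_hom_eq; first exact: hE.
by apply: hU => i; exact: (congr1 sval (kE i)).
Qed.

Lemma slice_retraction (X : E) (Y Z : slice X) (g : slice_hom Z Y)
    (f : slice_hom Y Z) :
  slice_comp g f = slice_id Y -> sval g \oc sval f = idm (Y : E).
Proof. exact: (congr1 (fun h : slice_hom Y Y => sval h)). Qed.

Variables (A : SET) (X T : E) (in_ : A -> hom X T) (pr : hom T X).
Hypotheses (in_coproduct : is_coproduct in_)
  (pr_in : forall a, pr \oc in_ a = idm X).

Definition slice_in (a : A) :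
  @hom (slice X) (SliceObj (idm X)) (SliceObj pr) := exist _ (in_ a) (pr_in a).

Definition slice_constant : constant_object (slice X) A.
Proof.
exists (SliceObj (idm X)) (SliceObj pr) slice_in.
- exact: slice_terminal.
- exact: slice_coproduct.
Defined.

End SliceConstants.

(** When [f] maps one constant object [K0] to a constant object, the degree 0
    comparison may be computed with [K0] and its image, and is then the action
    of [f] on the global sections of [K0]. *)
Section ConstantComparison.
Variables (E F : category) (f : functor E F) (A : SET).
Variable K0 : constant_object E A.
Hypothesis fK0_terminal : is_terminal (f (const_pt K0)).
Hypothesis fK0_coproduct : is_coproduct (fun a => fmap f (const_in K0 a)).

Definition image_constant : constant_object F A :=
  ConstantObject fK0_terminal fK0_coproduct.

Lemma H0_bijective_image : H0_bijective f A ->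
  bijective (fun s : hom (const_pt K0) (const_obj K0) => fmap f s).
Proof.
move=> /(_ K0 image_constant (idm _) (idm _)) [].
  by move=> a /=; rewrite comp_idl comp_idr.
move=> g gK Kg; exists g => s.
  by rewrite -[RHS]gK comp_idl comp_idr.
by rewrite -[RHS]Kg comp_idl comp_idr.
Qed.

(** The constant object is unique up to isomorphism, and so is the comparison;
    hence injectivity may be tested on a single constant object. *)
Lemma H0_injective_image :
  injective (fun s : hom (const_pt K0) (const_obj K0) => fmap f s) ->
  H0_injective f A.
Proof.
move=> f_inj K K' t c tc s s' /= css.
(* [p], [q] and [k], [l] identify [K] with [K0] *)
have [p _] := const_ptP K (const_pt K0).
have [q _] := const_ptP K0 (const_pt K).
have pq : p \oc q = idm _ by exact: terminal_uniq (const_ptP K) _ _ _.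
have [k [kE _]] := const_coproduct (c := K) (fun a => const_in K0 a \oc q).
have [l [lE _]] := const_coproduct (c := K0) (fun a => const_in K a \oc p).
have lk : l \oc k = idm _.
  apply: (coproduct_ext (@const_coproduct _ _ K)) => a.
  by rewrite -comp_assoc kE comp_assoc lE -comp_assoc pq comp_idr comp_idl.
have [r _] := const_ptP K' (f (const_pt K)).
have tr : t \oc r = idm _.
  have e : fmap f q \oc (t \oc r) = fmap f q by exact: terminal_uniq fK0_terminal _ _ _.
  by rewrite -[t \oc r]comp_idl -(fmap_id f) -pq fmap_comp -comp_assoc e.
(* [d] retracts the comparison [c], which can therefore be cancelled *)
have [d [dE _]] := const_coproduct (c := K') (fun a => fmap f (const_in K a) \oc t).
have dc : d \oc c = idm _.
  suff e : d \oc c \oc fmap f l = fmap f l.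
    rewrite -[LHS]comp_idr -(fmap_id f) -lk fmap_comp comp_assoc e.
    by rewrite -fmap_comp lk fmap_id.
  apply: (coproduct_ext fK0_coproduct) => a.
  rewrite -comp_assoc -fmap_comp lE fmap_comp comp_assoc.
  congr (_ \oc _); rewrite -[LHS]comp_idr -tr.
  transitivity (d \oc (c \oc fmap f (const_in K a) \oc t) \oc r).
    by rewrite !comp_assoc.
  by rewrite tc dE -comp_assoc tr comp_idr.
have {css} fss : fmap f s = fmap f s'.
  have cs : c \oc fmap f s = c \oc fmap f s'.
    by rewrite -[LHS]comp_idr -[RHS]comp_idr -tr !(comp_assoc _ t) css.
  by rewrite -[LHS]comp_idl -[RHS]comp_idl -dc -!comp_assoc cs.
have kss : k \oc s \oc p = k \oc s' \oc p.
  by apply: f_inj; rewrite /= !fmap_comp fss.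
have : l \oc (k \oc s \oc p) \oc q = l \oc (k \oc s' \oc p) \oc q by rewrite kss.
by rewrite -!comp_assoc pq !comp_idr !comp_assoc lk !comp_idl.
Qed.

End ConstantComparison.

(** In the application [f] is the pullback functor along a monomorphism
    [V -> U], [L] is composition with it, and [g] is the direct image. *)
Section AdjointTriple.
Variables (C D : category) (L : functor D C) (f : functor C D)
  (g : functor D C).
Variables (aL : adjunction L f) (aR : adjunction f g).
Variables (A : SET) (X T : C) (in_ : A -> hom X T) (pr : hom T X).
Hypotheses (in_coproduct : is_coproduct in_)
  (pr_in : forall a, pr \oc in_ a = idm X).

Let K0 := slice_constant in_coproduct pr_in.

Let fK0_terminal : is_terminal (slice_functor f X (const_pt K0)).
Proof. by apply: slice_terminal; exact: fmap_id. Qed.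

Let fK0_coproduct :
  is_coproduct (fun a => fmap (slice_functor f X) (const_in K0 a)).
Proof. apply: slice_coproduct; exact: (left_adjoint_coproduct aR). Qed.

Let section (s : hom X T) (prs : pr \oc s = idm X) :
  hom (const_pt K0) (const_obj K0) := exist _ s prs.

(** Transposing along [aL], the degree 0 comparison becomes the restriction of
    the sections of [T] over [X] along the counit, which for a pullback functor
    is the inclusion of the part of [X] lying over [V]. *)
Lemma H0_injective_sections :
  (forall s s', pr \oc s = idm X -> pr \oc s' = idm X ->
    s \oc counit aL X = s' \oc counit aL X -> s = s') ->
  H0_injective (slice_functor f X) A.
Proof.
move=> sec_inj; apply: (H0_injective_image fK0_terminal fK0_coproduct).
move=> [s prs] [s' prs'] /(congr1 sval) /= fss.
apply: slice_hom_eq => /=; apply: sec_inj prs prs' _.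
by apply: (adj_inj (a := aL)); rewrite !adj_comp_counit.
Qed.

Lemma H0_bijective_sections : H0_bijective (slice_functor f X) A ->
  forall c : hom (L (f X)) T, pr \oc c = counit aL X ->
  exists! s, pr \oc s = idm X /\ s \oc counit aL X = c.
Proof.
move=> /(H0_bijective_image fK0_terminal fK0_coproduct)[k kK Kk] c prc.
have fc : fmap f pr \oc adj aL c = fmap f (idm X).
  by rewrite -adj_postcomp prc adj_counit fmap_id.
pose c' : hom (slice_functor f X (const_pt K0))
  (slice_functor f X (const_obj K0)) := exist _ (adj aL c) fc.
exists (sval (k c')); split=> [|s [prs sc]].
  split; first exact: (svalP (k c')).
  apply: (adj_inj (a := aL)); rewrite adj_comp_counit.
  by move/(congr1 sval): (Kk c').
rewrite -[s]/(sval (section prs)) -(kK (section prs)); congr (sval (k _)).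
by apply: slice_hom_eq; rewrite /= -sc adj_comp_counit.
Qed.

End AdjointTriple.

(** * Sheaves on a space *)

Section Sheaves.
Variable S : topologicalType.
Implicit Types (O P W : opens S) (X Y Z : Sh S).

Local Notation "O <<= P" := ((O : set S) `<=` (P : set S))%classic (at level 70).

Definition sec X O : Type := (sval X : functor _ _) O.

Definition rs X O P (PO : P <<= O) (s : sec X O) : sec X P := restr PO s.

Definition ap X Y (f : hom X Y) O (s : sec X O) : sec Y O :=
  (f : nat_trans _ _) O s.

Lemma rs_id X O (OO : O <<= O) (s : sec X O) : rs OO s = s.
Proof.
have -> : OO = @idm (opposite (opens_category S)) O by exact: Prop_irrelevance.
by rewrite /rs /restr fmap_id.
Qed.

Lemma rs_rs X O P W (PO : P <<= O) (WP : W <<= P) (WO : W <<= O) (s : sec X O) :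
  rs WP (rs PO s) = rs WO s.
Proof.
have -> : WO = @compm (opposite (opens_category S)) O P W WP PO.
  exact: Prop_irrelevance.
by rewrite /rs /restr fmap_comp.
Qed.

Lemma ap_rs X Y (f : hom X Y) O P (PO : P <<= O) (s : sec X O) :
  ap f (rs PO s) = rs PO (ap f s).
Proof. exact: (congr1 (fun k => k s) (@nt_nat _ _ _ _ f O P PO)). Qed.

Lemma ap_comp X Y Z (g : hom Y Z) (f : hom X Y) O (s : sec X O) :
  ap (g \oc f) s = ap g (ap f s).
Proof. by []. Qed.

Lemma ap_id X O (s : sec X O) : ap (idm X) s = s.
Proof. by []. Qed.

Lemma hom_ext X Y (f g : hom X Y) :
  (forall O (s : sec X O), ap f s = ap g s) -> f = g.
Proof.
by move=> fg; apply: nat_trans_eq => O; exact: functional_extensionality_dep (fg O).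
Qed.

Definition mk_presheaf (F : opens S -> SET)
    (r : forall O P, P <<= O -> F O -> F P)
    (r_id : forall O (OO : O <<= O) s, r O O OO s = s)
    (r_comp : forall O P W (PO : P <<= O) (WP : W <<= P) (WO : W <<= O) s,
      r P W WP (r O P PO s) = r O W WO s) : presheaves S.
Proof.
unshelve refine (@Functor (opposite (opens_category S)) set_category F r _ _).
- by move=> O; exact: functional_extensionality_dep (r_id O _).
- move=> O P W PO WP; apply/esym.
  exact: functional_extensionality_dep (r_comp O P W _ _ _).
Defined.

Definition mk_hom X Y (f : forall O, sec X O -> sec Y O)
    (f_rs : forall O P (PO : P <<= O) s, f P (rs PO s) = rs PO (f O s)) :
  hom X Y.
Proof.
by exists f => O P PO; exact: functional_extensionality_dep (f_rs O P PO).
Defined.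

Lemma sheaf_sep X (I : Type) (V : I -> opens S) O (VO : forall i, V i <<= O) :
  (forall x, oset O x -> exists i, oset (V i) x) ->
  forall s s' : sec X O, (forall i, rs (VO i) s = rs (VO i) s') -> s = s'.
Proof.
move=> cov s s' ss.
pose C : set (opens S) := fun P => exists2 i, P <<= V i & P <<= O.
have CO P : C P -> P <<= O by case.
have cC x : oset O x <-> exists2 P, C P & oset P x.
  split=> [Ox|[P [i _ PO] /PO//]]; have [i Vx] := cov x Ox.
  by exists (V i) => //; exists i => //; exact: VO.
have [|t [_ tU]] := svalP X O C cC (fun P CP => rs (CO P CP) s).
  move=> P Q CP CQ W WP WQ; have WO := subset_trans WP (CO P CP).
  exact: etrans (rs_rs _ _ WO _) (esym (rs_rs _ _ _ _)).
rewrite -(tU s); last by move=> P CP PO; congr (rs _ s); exact: Prop_irrelevance.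
apply: tU => P CP PO.
have [i PV _] := CP; rewrite -[LHS](rs_rs (VO i) PV) -ss.
exact: rs_rs.
Qed.

(** Gluing along an indexed cover; the cover demanded by [is_sheaf] is the
    sieve it generates. *)
Lemma sheaf_glue X (I : Type) (V : I -> opens S) O (VO : forall i, V i <<= O)
    (s : forall i, sec X (V i)) :
  (forall x, oset O x -> exists i, oset (V i) x) ->
  (forall i j W (Wi : W <<= V i) (Wj : W <<= V j), rs Wi (s i) = rs Wj (s j)) ->
  exists t : sec X O, forall i, rs (VO i) t = s i.
Proof.
move=> cov comp.
pose C : set (opens S) := fun P => exists i, P <<= V i.
have cC x : oset O x <-> exists2 P, C P & oset P x.
  split=> [Ox|[P [i PV] /PV/VO//]]; have [i Vx] := cov x Ox.
  by exists (V i) => //; exists i.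
have [|t [tE _]] := svalP X O C cC (fun P CP => rs (svalP (cid CP)) (s _)).
  move=> P Q CP CQ W WP WQ.
  have Wi := subset_trans WP (svalP (cid CP)).
  have Wj := subset_trans WQ (svalP (cid CQ)).
  by rewrite [LHS](rs_rs _ _ Wi) [RHS](rs_rs _ _ Wj); exact: comp.
exists t => i; have CV : C (V i) by exists i.
rewrite -[RHS](rs_id (@subset_refl _ (V i))) [LHS](tE _ CV).
by rewrite (comp _ i _ _ (@subset_refl _ (V i))).
Qed.

(** The subterminal sheaf represented by [W]. *)
Definition open_presheaf W : presheaves S :=
  @mk_presheaf (fun O => O <<= W) (fun O P PO OW => subset_trans PO OW)
    (fun _ _ _ => Prop_irrelevance _ _)
    (fun _ _ _ _ _ _ _ => Prop_irrelevance _ _).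

Lemma open_is_sheaf W : is_sheaf (open_presheaf W).
Proof.
move=> O C cC s _.
have OW : O <<= W by move=> x /cC [P CP Px]; exact: (s P CP).
by exists OW; split=> [P CP PO|t _] /=; exact: Prop_irrelevance.
Qed.

Definition open_sheaf W : Sh S := exist _ _ (@open_is_sheaf W).

Lemma open_sheaf_eq W O (s s' : sec (open_sheaf W) O) : s = s'.
Proof. exact: (@Prop_irrelevance (O <<= W) s s'). Qed.

Lemma open_sheaf_hom_eq Z W (h k : hom Z (open_sheaf W)) : h = k.
Proof. by apply: hom_ext => O s; exact: open_sheaf_eq. Qed.

Definition prod_presheaf X Y : presheaves S.
Proof.
unshelve refine (@mk_presheaf (fun O => (sec X O * sec Y O)%type)
  (fun O P PO s => (rs PO s.1, rs PO s.2)) _ _).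
- by move=> O OO [s s'] /=; rewrite !rs_id.
- by move=> O P W PO WP WO [s s'] /=; rewrite !(rs_rs _ _ WO).
Defined.

Lemma prod_is_sheaf X Y : is_sheaf (prod_presheaf X Y).
Proof.
move=> O C cC s comp.
have [|t [tE tU]] := svalP X O C cC (fun P CP => (s P CP).1).
  move=> P Q CP CQ W WP WQ; exact: (congr1 fst (comp P Q CP CQ W WP WQ)).
have [|t' [tE' tU']] := svalP Y O C cC (fun P CP => (s P CP).2).
  move=> P Q CP CQ W WP WQ; exact: (congr1 snd (comp P Q CP CQ W WP WQ)).
exists (t, t'); split=> [P CP PO|[u u'] uE].
  rewrite [RHS]surjective_pairing.
  exact: (f_equal2 pair (tE P CP PO) (tE' P CP PO)).
apply: f_equal2; [apply: tU|apply: tU'] => P CP PO.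
  exact: (congr1 fst (uE P CP PO)).
exact: (congr1 snd (uE P CP PO)).
Qed.

Definition prod_sheaf X Y : Sh S := exist _ _ (@prod_is_sheaf X Y).

(** * Constant sheaves and copowers *)

Lemma open_bigunion (I : Type) (D : I -> set S) :
  (forall i, open (D i)) -> open (fun x => exists i, D i x).
Proof.
move=> oD; suff -> : (fun x => exists i, D i x) = (\bigcup_i D i)%classic.
  exact: bigcup_open.
by apply/funext => x; apply/propext; split=> [[i]|[i]]; exists i.
Qed.

(** Sections over [O] of the constant sheaf: a locally constant function
    [O -> A] is encoded by its fibres, so that restriction is intersection. *)
Record partition (A : SET) (O : opens S) := Partition {
  block :> A -> set S;
  block_open : forall a, open (block a);
  block_disj : forall a b x, block a x -> block b x -> a = b;
  block_cover : forall x, oset O x <-> exists a, block a x }.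

Lemma partition_eq A O (D D' : partition A O) :
  (forall a x, D a x -> D' a x) -> D = D'.
Proof.
case: D D' => [D oD dD cD] [D' oD' dD' cD'] /= DD'.
have e : D = D'.
  apply/funext => a; apply/funext => x; apply/propext; split=> [|D'x].
    exact: DD'.
  have /cD[b Dx] : oset O x by apply/cD'; exists a.
  by rewrite (dD' a b x D'x (DD' b x Dx)).
by subst D'; congr Partition; exact: Prop_irrelevance.
Qed.

Definition partition_rs A O P (PO : P <<= O) (D : partition A O) :
  partition A P.
Proof.
exists (fun a => D a `&` P)%classic.
- by move=> a; apply: openI; [exact: block_open|exact: oset_open].
- by move=> a b x [Da _] [Db _]; exact: block_disj Da Db.
- move=> x; split=> [Px|[a []//]].
  by have /(block_cover D)[a Da] := PO x Px; exists a.
Defined.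

Definition const_presheaf (A : SET) : presheaves S.
Proof.
unshelve refine (@mk_presheaf (partition A) (@partition_rs A) _ _).
- by move=> O OO D; apply: partition_eq => a x [].
- by move=> O P W PO WP WO D; apply: partition_eq => a x [[]].
Defined.

Lemma const_is_sheaf A : is_sheaf (const_presheaf A).
Proof.
move=> O C cC s comp.
have loc P Q (CP : C P) (CQ : C Q) a x :
    s P CP a x -> oset Q x -> s Q CQ a x.
  move=> sx Qx; have Px : oset P x by apply/(block_cover (s P CP)); exists a.
  pose W := Opens (openI (oset_open P) (oset_open Q)).
  have := comp P Q CP CQ W (@subIsetl _ _ _) (@subIsetr _ _ _).
  move/(congr1 (fun D : partition A W => D a x)) => /= e.
  have : (s P CP a `&` W)%classic x by split.
  by rewrite [X in X -> _]e => -[].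
unshelve eexists (@Partition A O
  (fun a x => exists P, exists CP : C P, s P CP a x) _ _ _).
- move=> a; apply: open_bigunion => P; apply: open_bigunion => CP.
  exact: block_open.
- move=> a b x [P [CP Px]] [Q [CQ Qx]].
  have xQ : oset Q x by apply/(block_cover (s Q CQ)); exists b.
  exact: block_disj (loc P Q CP CQ a x Px xQ) Qx.
- move=> x; split=> [/cC[P CP]|[a [P [CP sx]]]].
    by case/(block_cover (s P CP)) => a sx; exists a, P, CP.
  by apply/cC; exists P => //; apply/(block_cover (s P CP)); exists a.
split=> [P CP PO|t tE]; apply: partition_eq => a x /=.
  by case=> [[Q [CQ Qx]] Px]; exact: loc Qx Px.
case=> P [CP sx]; have Px : oset P x by apply/(block_cover (s P CP)); exists a.
have PO : P <<= O by move=> y Py; apply/cC; exists P.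
by move: sx; rewrite -(tE P CP PO) => -[].
Qed.

Definition const_sheaf A : Sh S := exist _ _ (@const_is_sheaf A).

Lemma sec_empty X O (s s' : sec X O) : (forall x, ~ oset O x) -> s = s'.
Proof.
move=> O0; pose VO (i : False) : O <<= O := @subset_refl _ _.
by apply: (@sheaf_sep X False _ O VO) => [x /O0|[]].
Qed.

Lemma open_and (Q : Prop) (B : set S) : open B -> open (fun x => Q /\ B x).
Proof.
move=> oB; have [q|nq] := pselect Q.
  suff -> : (fun x => Q /\ B x) = B by [].
  by apply/funext => x; apply/propext; split=> [[]|].
suff -> : (fun x => Q /\ B x) = set0 by exact: open0.
by apply/funext => x; apply/propext; split=> [[]|].
Qed.

Definition constant_partition (A : SET) (a : A) O : partition A O.
Proof.
exists (fun b x => b = a /\ oset O x).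
- by move=> b; exact/open_and/oset_open.
- by move=> b c x [-> _] [-> _].
- by move=> x; split=> [Ox|[b []//]]; exists a.
Defined.

Definition copower (A : SET) X : Sh S := prod_sheaf X (const_sheaf A).

Lemma copower_eq A X O (s s' : sec (copower A X) O) :
  s.1 = s'.1 -> (forall a x, s.2 a x -> s'.2 a x) -> s = s'.
Proof. by move=> e1 e2; apply: injective_projections => //; exact: partition_eq. Qed.

Definition copower_pr A X : hom (copower A X) X :=
  @mk_hom (copower A X) X (fun O => fst) (fun _ _ _ _ => erefl).

Definition copower_in A X (a : A) : hom X (copower A X).
Proof.
apply: (@mk_hom X (copower A X) (fun O s => (s, constant_partition a O))).
move=> O P PO s; apply: f_equal2; first by [].
by apply: partition_eq => b x /= [-> Px]; split=> //; split=> //; exact: PO.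
Defined.

Lemma copower_pr_in A X (a : A) :
  copower_pr A X \oc copower_in X a = idm X.
Proof. exact: hom_ext. Qed.

Section CopowerUniversal.
Variables (A : SET) (X Z : Sh S) (f : A -> hom X Z).

Definition block_opens O (D : partition A O) (a : A) : opens S :=
  Opens (block_open D a).

Lemma block_sub O (D : partition A O) a : block_opens D a <<= O.
Proof. by move=> x Dx; apply/(block_cover D); exists a. Qed.

(** The blocks of [D] cover [O] and on the block of index [a] the value must be
    that of [f a]; distinct blocks are disjoint, so these values glue. *)
Lemma copower_glue O (s : sec X O) (D : partition A O) :
  exists z : sec Z O,
    forall a, rs (@block_sub O D a) z = ap (f a) (rs (@block_sub O D a) s).
Proof.
apply: sheaf_glue => [x /(block_cover D)//|a b P Pa Pb].
have [ab|nab] := pselect (a = b).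
  subst b; congr rs; exact: Prop_irrelevance.
by apply: sec_empty => x Px; apply/nab/(block_disj (Pa x Px) (Pb x Px)).
Qed.

Lemma copower_sep O (D : partition A O) (z z' : sec Z O) :
  (forall a, rs (@block_sub O D a) z = rs (@block_sub O D a) z') -> z = z'.
Proof. by apply: sheaf_sep => x /(block_cover D). Qed.

Definition copower_out : hom (copower A X) Z.
Proof.
apply: (@mk_hom (copower A X) Z
  (fun O s => sval (cid (copower_glue s.1 s.2)))).
move=> O P PO [s D] /=; case: cid => z /= zE; case: cid => z' /= z'E.
apply: (@copower_sep _ (partition_rs PO D)) => a; rewrite zE.
have PaDa : block_opens (partition_rs PO D) a <<= block_opens D a.
  by move=> x [].
have PaO := subset_trans PaDa (@block_sub O D a).
rewrite (rs_rs _ _ PaO s) (rs_rs _ _ PaO z').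
by rewrite -!(rs_rs (@block_sub O D a) PaDa) z'E -ap_rs.
Defined.

End CopowerUniversal.

Lemma copower_coproduct A X : is_coproduct (copower_in X (A := A)).
Proof.
move=> Z f; exists (copower_out f); split=> [a|h hE]; apply: hom_ext => O s.
  rewrite ap_comp [LHS]/ap /=; case: cid => z /= zE.
  apply: (@copower_sep _ _ _ (constant_partition a O)) => b; rewrite zE.
  have [->|nab] := pselect (b = a); first exact: ap_rs.
  by apply: sec_empty => x [/nab].
case: s => s D; rewrite [LHS]/ap /=; case: cid => z /= zE.
apply: (@copower_sep _ _ _ D) => a; rewrite zE -hE ap_comp -ap_rs.
congr (ap h _); apply: f_equal2; first by [].
by apply: partition_eq => b x /= [-> Dx]; split.
Qed.

Section SliceCopower.
Variables (A : SET) (U : Sh S) (X : slice U).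

Definition slice_copower : slice U :=
  SliceObj (slice_arr X \oc copower_pr A X).

Definition slice_copower_pr : hom slice_copower X :=
  exist _ (copower_pr A X) erefl.

Definition slice_copower_in (a : A) : hom X slice_copower.
Proof.
exists (copower_in X a).
by rewrite -[LHS]comp_assoc copower_pr_in; exact: comp_idr.
Defined.

Lemma slice_copower_coproduct : is_coproduct slice_copower_in.
Proof. exact/slice_coproduct/copower_coproduct. Qed.

Lemma slice_copower_pr_in a :
  slice_copower_pr \oc slice_copower_in a = idm X.
Proof. exact/slice_hom_eq/copower_pr_in. Qed.

End SliceCopower.

(** The Yoneda correspondence. *)
Definition elt X W (s : sec X W) : hom (open_sheaf W) X.
Proof.
apply: (@mk_hom (open_sheaf W) X (fun O OW => rs OW s)).
by move=> O P PO OW; exact/esym/rs_rs.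
Defined.

Definition open_top W : sec (open_sheaf W) W := @subset_refl _ (W : set S).

Lemma elt_top X W (s : sec X W) : ap (elt s) (@open_top W) = s.
Proof. exact: rs_id. Qed.

Lemma mono_inj V U (m : hom V U) O : is_mono m -> injective (@ap V U m O).
Proof.
move=> mm s s' mss; suff e : elt s = elt s' by rewrite -(elt_top s) e elt_top.
apply: mm; apply: hom_ext => P PO.
by rewrite !ap_comp [ap (elt s) _]/ap [ap (elt s') _]/ap /= !ap_rs mss.
Qed.

(** A monomorphism is injective on sections, so preimages found locally
    glue. *)
Lemma mono_locally_onto V U (m : hom V U) : is_mono m ->
  (forall W (u : sec U W) x, oset W x ->
    exists P (PW : P <<= W) (v : sec V P), oset P x /\ ap m v = rs PW u) ->
  exists k : hom U V, k \oc m = idm V /\ m \oc k = idm U.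
Proof.
move=> mm onto.
have inv W (u : sec U W) : exists v : sec V W, ap m v = u.
  pose I := {P : opens S & {PW : P <<= W & {v : sec V P | ap m v = rs PW u}}}.
  pose P_ (i : I) := projT1 i.
  pose PW (i : I) : P_ i <<= W := projT1 (projT2 i).
  pose v (i : I) : sec V (P_ i) := sval (projT2 (projT2 i)).
  have vE i : ap m (v i) = rs (PW i) u by exact: svalP (projT2 (projT2 i)).
  have cov x : oset W x -> exists i, oset (P_ i) x.
    move=> /(onto W u)[P [PW' [w [Px wE]]]].
    by exists (existT _ P (existT _ PW' (exist _ w wE))); exact: Px.
  have [|t tE] := sheaf_glue PW (s := v) cov.
    move=> i j O Oi Oj; apply: (mono_inj mm); rewrite !ap_rs !vE.
    have OW := subset_trans Oi (PW i).
    by rewrite (rs_rs (PW i) Oi OW) (rs_rs (PW j) Oj OW).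
  exists t; apply: (sheaf_sep (VO := PW) cov) => i.
  by rewrite -ap_rs tE vE.
pose k W u := sval (cid (inv W u)).
have kE W u : ap m (k W u) = u by exact: svalP (cid (inv W u)).
unshelve eexists (@mk_hom U V k _).
  by move=> O P PO u; apply: (mono_inj mm); rewrite ap_rs !kE.
split; apply: hom_ext => O s; rewrite ap_comp ap_id; last exact: kE.
by apply: (mono_inj mm); exact: kE.
Qed.

(** * 0-pure monomorphisms *)

Definition clopen_point (x : S) : Prop := exists N : nat -> set S,
  (forall k, [/\ open (N k), open (~` N k)%classic & N k x]) /\
  forall y, y <> x -> exists k, ~ N k y.

Section Level.
Variables (x : S) (N : nat -> set S).
Hypotheses (N_open : forall k, open (N k)) (NC_open : forall k, open (~` N k)%classic)
  (N_sep : forall y, y <> x -> exists k, ~ N k y).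

(** The fibres of a locally constant function on the complement of [x] that
    tends to infinity at [x]. *)
Definition level (k : nat) : set S :=
  fun y => (forall j, j < k -> N j y) /\ ~ N k y.

Lemma level_open k : open (level k).
Proof.
apply: openI (NC_open k); elim: k => [|k IHk].
  suff -> : (fun y => forall j, j < 0 -> N j y) = setT by exact: openT.
  by apply/funext => y; apply/propext; split.
suff -> : (fun y => forall j, j < k.+1 -> N j y) =
    ((fun y => forall j, j < k -> N j y) `&` N k)%classic.
  exact: openI (N_open k).
apply/funext => y; apply/propext; split=> [Ny|[Ny Nk] j].
  by split=> [j jk|]; apply: Ny => //; exact: ltnW.
by rewrite ltnS leq_eqVlt => /orP[/eqP->|/Ny].
Qed.

Lemma level_disj j k y : level j y -> level k y -> j = k.
Proof.
by move=> [jN jN'] [kN kN']; case: (ltngtP j k) => // [/kN|/jN].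
Qed.

Lemma level_cover y : y <> x -> exists k, level k y.
Proof.
move=> /N_sep ex; have /ex_minnP[k /asboolP kN kmin] : exists k, `[< ~ N k y >].
  by case: ex => k ?; exists k; exact/asboolP.
exists k; split=> // j jk; apply: contrapT => jN.
by have := kmin j (asboolT jN); rewrite leqNgt jk.
Qed.

Definition level_partition O (Ox : ~ oset O x) : partition nat O.
Proof.
exists (fun k y => oset O y /\ level k y).
- by move=> k; apply: openI; [exact: oset_open|exact: level_open].
- by move=> j k y [_ yj] [_ yk]; exact: level_disj yj yk.
- move=> y; split=> [Oy|[k []//]].
  have [|k yk] := @level_cover y; first by move=> yx; rewrite yx in Oy.
  by exists k.
Defined.

(** Changes the value [n] to [n.+1] on [N n].  Since [level n] is disjoint from
    [N n], this is invisible where [D] is the partition into levels. *)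
Definition modify_partition O (D : partition nat O) (n : nat) : partition nat O.
Proof.
exists (fun k y => (D k y /\ (k = n -> ~ N n y)) \/ (k = n.+1 /\ (D n y /\ N n y))).
- move=> k; apply: openU.
    have [kn|kn] := pselect (k = n).
      suff -> : (fun y => D k y /\ (k = n -> ~ N n y)) = (D k `&` ~` N n)%classic.
        exact: openI (block_open _ _) (NC_open _).
      by apply/funext => y; apply/propext; split=> -[Dy Ny]; split=> //; exact: Ny.
    suff -> : (fun y => D k y /\ (k = n -> ~ N n y)) = D k by exact: block_open.
    by apply/funext => y; apply/propext; split=> [[]//|Dy]; split=> // /kn.
  exact/open_and/openI/N_open/block_open.
- have excl k y : D k y -> (k = n -> ~ N n y) -> D n y -> N n y -> False.
    by move=> Dk kn Dn; apply: (kn (block_disj Dk Dn)).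
  move=> j k y [[Dj jn]|[-> [Dn Nn]]] [[Dk kn]|[-> [Dn' Nn']]] //.
  + exact: block_disj Dj Dk.
  + by case: (excl _ _ Dj jn Dn' Nn').
  + by case: (excl _ _ Dk kn Dn Nn).
- move=> y; split=> [/(block_cover D)[k Dy]|[k [[Dy _]|[_ [Dy _]]]]].
  + have [Ny|Ny] := pselect (N n y); last by exists k; left.
    have [kn|kn] := pselect (k = n); last by exists k; left.
    by exists n.+1; right; rewrite -kn in Ny *.
  + by apply/(block_cover D); exists k.
  + by apply/(block_cover D); exists n.
Defined.

End Level.

Section ZeroPure.
Variables (V U : Sh S) (m : hom V U).

(** The core of the argument: a section [u] over [W] that does not come from [V]
    near [x] defines an object [X] of the slice over [U], and the part of [X]
    lying over [V] avoids [x].  There the partition into levels makes sense; by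
    purity it extends to a unique partition of [W], yet two extensions exist. *)
Lemma zero_pure_locally_onto W (u : sec U W) x : oset W x -> clopen_point x ->
  pure_mono 0 m ->
  exists P (PW : P <<= W) (v : sec V P), oset P x /\ ap m v = rs PW u.
Proof.
move=> Wx [N [Nclopen N_sep]] [_ [rho [[aL] pure]]]; apply: contrapT => notonto.
have N_open k : open (N k) by have [] := Nclopen k.
have NC_open k : open (~` N k)%classic by have [] := Nclopen k.
set f := inverse_image rho in aL pure.
pose X : slice U := SliceObj (elt u).
(* sections of [slice_dom (f X)] over [O] witness that [O] is contained in [W]
   and that [u] comes from [V] on [O] *)
pose eps : slice_hom _ _ := counit aL X.
have no_x O (p : sec (slice_dom (f X)) O) : ~ oset O x.
  move=> Ox; apply: notonto; have OW : O <<= W := ap (sval eps) p.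
  exists O, OW, (ap (slice_arr (f X)) p); split=> //.
  have := congr1 (fun h => ap h p) (svalP eps).
  rewrite -[LHS]/(rs (ap (sval eps) p) u) -[RHS]/(ap m _) => <-.
  by congr rs; exact: open_sheaf_eq.
(* the partition into levels, as a map to the copower of [X] *)
unshelve epose (c0 := @mk_hom (slice_dom (f X)) (copower nat (open_sheaf W))
  (fun O p => (ap (sval eps) p,
     level_partition N_open NC_open N_sep (no_x O p))) _).
  move=> O P PO p; apply: f_equal2; first exact: open_sheaf_eq.
  by apply: partition_eq => k y /= [Py Ny]; split=> //; split=> //; exact: PO.
unshelve epose (c := exist _ c0 _ : slice_hom (slice_sum m (f X)) (slice_copower nat X)).
  by apply: etrans (svalP eps); exact: hom_ext.
have [|s [[prs sc] sU]] := H0_bijective_sections (aL := aL) (geom_adj rho)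
  (@slice_copower_coproduct nat U X) (slice_copower_pr_in X)
  (pure X 0%N isT nat) (c := c).
  by apply: slice_hom_eq; apply: hom_ext.
pose D : partition nat W := (ap (sval s) (@open_top W)).2.
have [n Dx] : exists n, D n x by exact/(block_cover D).
have DE O (p : sec (slice_dom (f X)) O) k y :
    D k y -> oset O y -> level N k y.
  move=> Dy Oy.
  have OW : O <<= W := ap (sval eps) p.
  have sp : ap (sval s) (ap (sval eps) p) = ap c0 p.
    by rewrite -[c0]/(sval c) -sc.
  have : (rs OW (ap (sval s) (@open_top W))).2 k y by [].
  rewrite -ap_rs (open_sheaf_eq (rs _ _) (ap (sval eps) p)) sp.
  by case.
(* [D'] is a second extension of the partition into levels: it differs from
   [D] at [x] *)
pose D' := modify_partition N_open NC_open D n.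
unshelve epose (s' := exist _ (elt (X := copower nat (open_sheaf W))
  (@open_top W, D')) _ : slice_hom X (slice_copower nat X)).
  by apply: hom_ext => O OW; rewrite -comp_assoc ap_comp; congr ap; exact: open_sheaf_eq.
have ss' : s = s'.
  apply: sU; split; apply: slice_hom_eq; apply: hom_ext => O p.
    exact: open_sheaf_eq.
  apply: (@copower_eq nat (open_sheaf W)); first exact: open_sheaf_eq.
  move=> k y [[[Dy Ny]|[_ [Dy Ny]]] Oy].
    by split=> //; exact: DE p _ _ Dy Oy.
  by case: (DE _ p _ _ Dy Oy) => _ /(_ Ny).
have : (ap (sval s') (@open_top W)).2 n x by rewrite -ss'.
have [_ _ Nx] := Nclopen n.
case=> -[[_ /(_ erefl)/(_ Nx)//]|[/eqP + _]].
by rewrite eqn_leq ltnn andbF.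
Qed.

End ZeroPure.

(** * The inclusion of a dense open subspace *)

Section OpenInclusion.
Variable W0 : opens S.

Definition opens_top : opens S := Opens openT.

Definition to_top X : hom X (open_sheaf opens_top) :=
  @mk_hom X (open_sheaf opens_top) (fun O _ => @subsetT _ (O : set S))
    (fun _ _ _ _ => open_sheaf_eq _ _).

Definition open_incl : hom (open_sheaf W0) (open_sheaf opens_top) :=
  to_top (open_sheaf W0).

Lemma open_incl_mono : is_mono open_incl.
Proof. by move=> Z g h _; exact: open_sheaf_hom_eq. Qed.

Local Notation U := (open_sheaf opens_top).
Local Notation V := (open_sheaf W0).

Definition meetW O : opens S := Opens (openI (oset_open O) (oset_open W0)).

Lemma meetWS O P : P <<= O -> meetW P <<= meetW O.
Proof. by move=> PO x [Px Wx]; split=> //; exact: PO. Qed.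

(** The direct image: sections over [O] are sections over the part of [O] inside
    [W0].  It is used on sheaves over [V], that is on sheaves all of whose
    sections live inside [W0]. *)
Definition ext_presheaf X : presheaves S :=
  @mk_presheaf (fun O => sec X (meetW O)) (fun O P PO => rs (meetWS PO))
    (fun O OO s => rs_id _ s)
    (fun O P W PO WP WO s => rs_rs _ _ _ s).

Lemma ext_is_sheaf X : is_sheaf (ext_presheaf X).
Proof.
move=> O C cC s comp.
pose I := {P : opens S | C P}.
pose P_ (i : I) : opens S := meetW (sval i).
have PO (i : I) : P_ i <<= meetW O.
  by apply: meetWS => x Px; apply/cC; exists (sval i) => //; exact: (proj2_sig i).
have cov x : oset (meetW O) x -> exists i, oset (P_ i) x.
  by case=> /cC[P CP Px] Wx; exists (exist _ P CP).
have [|t tE] := sheaf_glue PO (s := fun i => s (sval i) (proj2_sig i)) cov.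
  move=> i j W Wi Wj.
  have Wi' : W <<= sval i by move=> x /Wi[].
  have Wj' : W <<= sval j by move=> x /Wj[].
  have WW : W <<= meetW W by move=> x Wx; split=> //; have [] := Wi x Wx.
  have := congr1 (rs WW) (comp _ _ (proj2_sig i) (proj2_sig j) W Wi' Wj').
  by rewrite /restr /= !(rs_rs _ WW Wi) !(rs_rs _ WW Wj).
exists t; split=> [P CP PO'|t' t'E].
  have e : rs (meetWS PO') t = s P CP.
    rewrite (Prop_irrelevance (meetWS PO') (PO (exist _ P CP))).
    exact: (tE (exist _ P CP)).
  exact: e.
apply: (sheaf_sep (VO := PO) cov) => i; rewrite tE.
have iO : sval i <<= O by move=> x ix; apply/cC; exists (sval i) => //; exact: (proj2_sig i).
rewrite -(t'E _ (proj2_sig i) iO).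
by congr (rs _ t'); exact: Prop_irrelevance.
Qed.

Definition ext_sheaf X : Sh S := exist _ _ (@ext_is_sheaf X).

Definition ext_map X Y (h : hom X Y) : hom (ext_sheaf X) (ext_sheaf Y) :=
  @mk_hom (ext_sheaf X) (ext_sheaf Y) (fun O s => ap h s)
    (fun O P PO s => ap_rs h (meetWS PO) s).

Lemma ext_map_id X : ext_map (idm X) = idm (ext_sheaf X).
Proof. exact: hom_ext. Qed.

Lemma ext_map_comp X Y Z (h : hom Y Z) (k : hom X Y) :
  ext_map (h \oc k) = ext_map h \oc ext_map k.
Proof. exact: hom_ext. Qed.

Definition ext_functor : functor (slice V) (slice U).
Proof.
unshelve refine (@Functor (slice V) (slice U)
  (fun Z : slice V => SliceObj (to_top (ext_sheaf Z)))
  (fun (Y Z : slice V) h => exist _ (ext_map (sval h)) (open_sheaf_hom_eq _ _)) _ _).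
- by move=> X; apply: slice_hom_eq; exact: ext_map_id.
- by move=> X Y Z h k; apply: slice_hom_eq; exact: ext_map_comp.
Defined.

(** The inverse image of [X] is its product with [V], the part of [X] lying over
    [W0]. *)
Definition part_fst X : hom (prod_sheaf V X) V :=
  @mk_hom (prod_sheaf V X) V (fun O => fst) (fun _ _ _ _ => erefl).

Definition part_snd X : hom (prod_sheaf V X) X :=
  @mk_hom (prod_sheaf V X) X (fun O => snd) (fun _ _ _ _ => erefl).

Definition part_pair Z X (h : hom Z V) (k : hom Z X) : hom Z (prod_sheaf V X).
Proof.
apply: (@mk_hom Z (prod_sheaf V X) (fun O s => (ap h s, ap k s))).
by move=> O P PO s; apply: f_equal2; exact: ap_rs.
Defined.

Lemma part_eq X O (s s' : sec (prod_sheaf V X) O) : s.2 = s'.2 -> s = s'.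
Proof. by move=> e; apply: injective_projections => //; exact: open_sheaf_eq. Qed.

Lemma part_hom_eq Z X (h k : hom Z (prod_sheaf V X)) :
  part_snd X \oc h = part_snd X \oc k -> h = k.
Proof.
move=> e; apply: hom_ext => O s; apply: part_eq.
exact: (congr1 (fun l => ap l s) e).
Qed.

Lemma part_snd_pair Z X (h : hom Z V) (k : hom Z X) :
  part_snd X \oc part_pair h k = k.
Proof. exact: hom_ext. Qed.

Definition part_map X Y (h : hom X Y) : hom (prod_sheaf V X) (prod_sheaf V Y) :=
  part_pair (part_fst X) (h \oc part_snd X).

Lemma part_snd_map X Y (h : hom X Y) :
  part_snd Y \oc part_map h = h \oc part_snd X.
Proof. exact: part_snd_pair. Qed.

Lemma part_map_id X : part_map (idm X) = idm (prod_sheaf V X).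
Proof. by apply: part_hom_eq; rewrite part_snd_map comp_idl comp_idr. Qed.

Lemma part_map_comp X Y Z (h : hom Y Z) (k : hom X Y) :
  part_map (h \oc k) = part_map h \oc part_map k.
Proof.
apply: part_hom_eq.
by rewrite comp_assoc !part_snd_map -!comp_assoc part_snd_map.
Qed.

Lemma part_pair_nat Z T X Y (z : hom Z V) (t : hom T V)
    (k : hom X Y) (h : hom Z X) (g : hom T Z) :
  part_pair t (k \oc h \oc g) = part_map k \oc part_pair z h \oc g.
Proof.
apply: part_hom_eq; rewrite part_snd_pair !comp_assoc part_snd_map.
by rewrite -(comp_assoc k (part_snd X)) part_snd_pair.
Qed.

Definition part_functor : functor (slice U) (slice V).
Proof.
unshelve refine (@Functor (slice U) (slice V)
  (fun X : slice U => SliceObj (part_fst X))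
  (fun (X Y : slice U) h => exist _ (part_map (sval h)) (open_sheaf_hom_eq _ _)) _ _).
- by move=> X; apply: slice_hom_eq; exact: part_map_id.
- by move=> X Y Z h k; apply: slice_hom_eq; exact: part_map_comp.
Defined.

Definition sum_part_adj (X : slice V) (Y : slice U)
    (h : slice_hom (slice_sum open_incl X) Y) : slice_hom X (part_functor Y) :=
  exist _ (part_pair (slice_arr X) (sval h)) (open_sheaf_hom_eq _ _).

Definition sum_part_adj_inv (X : slice V) (Y : slice U)
    (h : slice_hom X (part_functor Y)) : slice_hom (slice_sum open_incl X) Y :=
  exist _ (part_snd Y \oc sval h) (open_sheaf_hom_eq _ _).

Lemma sum_part_adj_nat (X X' : slice V) (Y Y' : slice U) (g : hom X' X)
    (h : slice_hom (slice_sum open_incl X) Y) (k : hom Y Y') :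
  sum_part_adj (k \oc h \oc fmap (slice_sum open_incl) g : slice_hom _ _) =
  fmap part_functor k \oc sum_part_adj h \oc g.
Proof.
by apply: slice_hom_eq; exact: part_pair_nat.
Qed.

Definition sum_part_adjunction : adjunction (slice_sum open_incl) part_functor.
Proof.
exists sum_part_adj sum_part_adj_inv; last exact: sum_part_adj_nat.
- by move=> X Y h; apply: slice_hom_eq; exact: part_snd_pair.
- by move=> X Y h; apply: slice_hom_eq; apply: part_hom_eq; exact: part_snd_pair.
Defined.

Lemma meetW_sub O : meetW O <<= O. Proof. by move=> x []. Qed.

Lemma meetW_subW O : meetW O <<= W0. Proof. by move=> x []. Qed.

Lemma sub_meetW O : O <<= W0 -> O <<= meetW O.
Proof. by move=> OW x Ox; split=> //; exact: OW. Qed.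

Definition restrict_part X O (s : sec X O) : sec (prod_sheaf V X) (meetW O) :=
  (@meetW_subW O, rs (@meetW_sub O) s).

Lemma restrict_part_rs X O P (PO : P <<= O) (s : sec X O) :
  restrict_part (rs PO s) = rs (meetWS PO) (restrict_part s).
Proof.
by apply: part_eq; rewrite /= !(rs_rs _ _ (subset_trans (@meetW_sub P) PO)).
Qed.

Lemma rs_restrict_part X O (s : sec (prod_sheaf V X) O) :
  rs (sub_meetW s.1) (restrict_part s.2) = s.
Proof. by apply: part_eq; rewrite /= (rs_rs _ _ (@subset_refl _ (O : set S))) rs_id. Qed.

Definition part_ext_map X Z (h : hom (prod_sheaf V X) Z) : hom X (ext_sheaf Z).
Proof.
apply: (@mk_hom X (ext_sheaf Z) (fun O s => ap h (restrict_part s))).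
by move=> O P PO s; rewrite restrict_part_rs ap_rs.
Defined.

Definition part_ext_inv X Z (h : hom X (ext_sheaf Z)) : hom (prod_sheaf V X) Z.
Proof.
apply: (@mk_hom (prod_sheaf V X) Z (fun O s =>
  rs (sub_meetW s.1) (ap h s.2 : sec Z (meetW O)))).
move=> O P PO s; have PO' := subset_trans PO (sub_meetW s.1).
by rewrite ap_rs (rs_rs _ _ PO') [LHS](rs_rs _ _ PO').
Defined.

Lemma part_ext_mapK X Z : cancel (@part_ext_map X Z) (@part_ext_inv X Z).
Proof.
move=> h; apply: hom_ext => O s.
by rewrite -[LHS]/(rs _ (ap h (restrict_part s.2))) -ap_rs rs_restrict_part.
Qed.

Lemma part_ext_invK X Z : cancel (@part_ext_inv X Z) (@part_ext_map X Z).
Proof.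
move=> h; apply: hom_ext => O s.
rewrite -[LHS]/(rs _ (ap h (rs (@meetW_sub O) s) : sec Z (meetW (meetW O)))).
rewrite ap_rs [LHS](rs_rs _ _ (@subset_refl _ (meetW O : set S))).
exact: (@rs_id Z (meetW O) _ (ap h s)).
Qed.

Lemma part_ext_map_nat X' X Z Z' (g : hom X' X) (h : hom (prod_sheaf V X) Z)
    (k : hom Z Z') :
  part_ext_map (k \oc h \oc part_map g) = ext_map k \oc part_ext_map h \oc g.
Proof.
apply: hom_ext => O s.
have e : ap (part_map g) (restrict_part s) = restrict_part (ap g s).
  by apply: part_eq; exact: ap_rs.
exact: (congr1 (fun q => ap k (ap h q)) e).
Qed.

Definition part_ext_adj (X : slice U) (Z : slice V)
    (h : slice_hom (part_functor X) Z) : slice_hom X (ext_functor Z) :=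
  exist _ (part_ext_map (sval h)) (open_sheaf_hom_eq _ _).

Definition part_ext_adj_inv (X : slice U) (Z : slice V)
    (h : slice_hom X (ext_functor Z)) : slice_hom (part_functor X) Z :=
  exist _ (part_ext_inv (sval h)) (open_sheaf_hom_eq _ _).

Lemma part_ext_adj_nat (X X' : slice U) (Y Y' : slice V) (g : hom X' X)
    (h : slice_hom (part_functor X) Y) (k : hom Y Y') :
  part_ext_adj (k \oc h \oc fmap part_functor g : slice_hom _ _) =
  fmap ext_functor k \oc part_ext_adj h \oc g.
Proof.
by apply: slice_hom_eq; exact: part_ext_map_nat.
Qed.

Definition part_ext_adjunction : adjunction part_functor ext_functor.
Proof.
exists part_ext_adj part_ext_adj_inv; last exact: part_ext_adj_nat.
- by move=> X Z h; apply: slice_hom_eq; exact: part_ext_mapK.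
- by move=> X Z h; apply: slice_hom_eq; exact: part_ext_invK.
Defined.

Definition open_incl_geometric : geometric_morphism (slice V) (slice U) :=
  GeometricMorphism part_ext_adjunction (right_adjoint_lex sum_part_adjunction).

Lemma sum_part_counit_inj (X Y : slice U) (s s' : slice_hom X Y) :
  slice_comp s (counit sum_part_adjunction X) =
    slice_comp s' (counit sum_part_adjunction X) ->
  sval s \oc part_snd X = sval s' \oc part_snd X.
Proof.
have counitE (t : slice_hom X Y) :
    sval (slice_comp t (counit sum_part_adjunction X)) = sval t \oc part_snd X.
  exact: (congr1 (fun h => sval t \oc h) (comp_idr _)).
by move=> e; rewrite -(counitE s) -(counitE s') e.
Qed.

(** If two blocks of index [a] and [b] meet, they meet in a point of the dense
    subset, where both functions take the same value. *)
Lemma dense_const_sep A O (D D' : partition A O) : dense (W0 : set S) ->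
  partition_rs (@meetW_sub O) D = partition_rs (@meetW_sub O) D' -> D = D'.
Proof.
move=> dW DD'; apply: partition_eq => a y Da.
have [b D'b] : exists b, D' b y by apply/(block_cover D')/(block_cover D); exists a.
have /(dW _)/(_ (openI (block_open D a) (block_open D' b))) :
    (D a `&` D' b !=set0)%classic by exists y.
move=> [z [[Daz D'bz] Wz]].
have Oz : oset O z by apply/(block_cover D); exists a.
have : partition_rs (@meetW_sub O) D a z by [].
by rewrite DD' => -[D'az _]; rewrite (block_disj D'az D'bz).
Qed.

Lemma dense_copower_sep A X (s s' : hom X (copower A X)) : dense (W0 : set S) ->
  copower_pr A X \oc s = idm X -> copower_pr A X \oc s' = idm X ->
  s \oc part_snd X = s' \oc part_snd X -> s = s'.
Proof.
move=> dW prs prs' ss; apply: hom_ext => O p; apply: injective_projections.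
  transitivity p; first exact: (congr1 (fun h => ap h p) prs).
  exact/esym/(congr1 (fun h => ap h p) prs').
apply: dense_const_sep dW _.
have /(congr1 snd) : rs (@meetW_sub O) (ap s p) = rs (@meetW_sub O) (ap s' p).
  by rewrite -!ap_rs; exact: (congr1 (fun h => ap h (restrict_part p)) ss).
exact.
Qed.

Lemma slice_copower_sep A (X : slice U) (s s' : slice_hom X (slice_copower A X)) :
  dense (W0 : set S) ->
  slice_comp (slice_copower_pr A X) s = slice_id X ->
  slice_comp (slice_copower_pr A X) s' = slice_id X ->
  slice_comp s (counit sum_part_adjunction X) =
    slice_comp s' (counit sum_part_adjunction X) -> s = s'.
Proof.
move=> dW prs prs' ss.
apply: slice_hom_eq; apply: dense_copower_sep dW _ _ (sum_part_counit_inj ss).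
  exact: slice_retraction prs.
exact: slice_retraction prs'.
Qed.

(** The comparison in degree 0 over [X] restricts a section of the copower to
    the part of [X] over [W0]. *)
Lemma dense_open_pure : dense (W0 : set S) -> pure_mono (-1) open_incl.
Proof.
move=> dW; split; first exact: open_incl_mono.
exists open_incl_geometric; split; first exact: inhabits sum_part_adjunction.
move=> X A; apply: (H0_injective_sections (aL := sum_part_adjunction)
  part_ext_adjunction (@slice_copower_coproduct A _ X) (slice_copower_pr_in X)).
by move=> s s'; exact: slice_copower_sep dW.
Qed.

End OpenInclusion.

Local Open Scope ring_scope.

Lemma clopen_points_E_le1 : (forall x : S, clopen_point x) ->
  forall F : Sh S, E_le 1 F.
Proof.
move=> clop F V U m pm.
have [|k [km mk]] := mono_locally_onto (m := m) (proj1 pm).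
  by move=> W u x Wx; exact: (zero_pure_locally_onto u Wx (clop x) pm).
move=> f; exists (f \oc k); split=> [|g gm].
  by rewrite -comp_assoc km comp_idr.
by rewrite -gm -comp_assoc mk comp_idr.
Qed.

(** Every (-1)-pure monomorphism is (-2)-pure, so the inclusion of [W0] serves
    for both values of [k].  An extension of the identity of [open_sheaf W0]
    would be a global section of it. *)
Lemma dense_open_not_E_le (W0 : opens S) : dense (W0 : set S) ->
  (W0 : set S) <> setT -> forall k : int, -1 <= k -> k <= 0 ->
  ~ E_le k (open_sheaf W0).
Proof.
move=> dW W0T k k1 k0 le; have pm : pure_mono (k - 1) (open_incl W0).
  case: k k1 k0 {le} => [[|k]|[|k]] //= _ _; first exact: dense_open_pure.
  have [mm [rho [aL _]]] := dense_open_pure dW.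
  by split=> //; exists rho.
have [g _] := le _ _ _ pm (idm _).
apply: W0T; apply/seteqP; split=> // x _.
exact: (ap g (@open_top opens_top)).
Qed.

(** As [E_le 1] is everything, so is the union [E_lt_infty] containing it. *)
Theorem dense_open_one_dimensional : (forall x : S, clopen_point x) ->
  (exists W0 : opens S, dense (W0 : set S) /\ (W0 : set S) <> setT) ->
  is_dimensional (Sh S) 1.
Proof.
move=> clop [W0 [dW W0T]]; have le1 := clopen_points_E_le1 clop.
have ltoo (F : Sh S) : E_lt_infty F.
  by move=> P _ leP; exact: (leP 1 isT F (le1 F)).
split=> // k k1 kE; rewrite leNgt; apply/negP; rewrite -[1]add0r ltzD1 => k0.
exact: (dense_open_not_E_le dW W0T k1 k0 (proj2 (kE _) (ltoo _))).
Qed.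

End Sheaves.

(** * The rational numbers *)

Local Open Scope ring_scope.

(** The square root of 2 is irrational: compare the parities of the exponents
    of 2.  It provides radii at which intervals of rationals are clopen. *)
Lemma sqr_rat_neq2 (r : rat) : r ^+ 2 != 2.
Proof.
apply/eqP => r2; have d0 := denq_neq0 r.
have {r2} : numq r ^+ 2 = 2 * denq r ^+ 2.
  apply: (@intr_inj rat); rewrite [RHS]rmorphM !rmorphXn /=.
  by rewrite -[2%:~R]/(2 : rat) -r2 -exprMn -numqE.
move/(congr1 absz); rewrite abszM !abszX /= => /(congr1 (logn 2)).
rewrite lognM ?expn_gt0 ?absz_gt0 ?d0 // !lognX (@logn_prime 2 2) // => /(congr1 odd).
by rewrite oddD !oddM.
Qed.

Section ScaledSquare.
Import numFieldNormedType.Exports.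

Lemma scaled_sqr_continuous (R : realFieldType) (x c : R) :
  continuous (fun y : R => ((y - x) * c) ^+ 2 : R).
Proof.
have c1 : continuous (fun y : R => (y - x) * c).
  move=> y; apply: (@continuousM R R (fun y => y - x) (fun=> c)).
    by apply: (@continuousB R R R); [exact: cvg_id|exact: cst_continuous].
  exact: cst_continuous.
move=> y; under eq_fun do rewrite expr2.
exact: (@continuousM R R _ _ y (c1 y) (c1 y)).
Qed.

End ScaledSquare.

Section RationalClopens.
Variable x : (rat^o)%R.

Let scaled (k : nat) : (rat^o)%R -> (rat^o)%R :=
  fun y => ((y - x) * k.+1%:R) ^+ 2.

Let scaled_continuous k : continuous (scaled k).
Proof. exact: scaled_sqr_continuous. Qed.

Lemma rat_clopen_point : clopen_point x.
Proof.
(* the interval of radius [sqrt 2 / k.+1] around [x] *)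
exists (fun k y => scaled k y < 2); split=> [k|y /eqP yx].
  split.
  - exact: (open_comp (fun y _ => @scaled_continuous k y) (@open_lt rat 2)).
  - have -> : (~` (fun y => scaled k y < 2))%classic =
        (scaled k @^-1` [set z | 2 < z])%classic.
      apply/funext => y; apply/propext; rewrite /setC /=.
      have : scaled k y != 2 by exact: sqr_rat_neq2.
      by case: ltgtP => // _ _; split.
    exact: (open_comp (fun y _ => @scaled_continuous k y) (@open_gt rat 2)).
  - by rewrite /scaled subrr mul0r expr0n.
have e0 : 0 < `|y - x| by rewrite normr_gt0 subr_eq0.
exists (Num.truncn (2 / `|y - x|)); rewrite /scaled -real_normK ?num_real //.
apply/negP; rewrite -leNgt normrM normr_nat.
set k := Num.truncn _.
have : 2 <= `|y - x| * k.+1%:R.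
  by rewrite mulrC -ler_pdivrMr // ltW // truncnS_gt.
move=> b2; apply: (le_trans b2); rewrite expr2 ler_peMl //.
  exact: le_trans b2.
exact: (le_trans _ b2).
Qed.

End RationalClopens.

Theorem proposition8p9 : is_dimensional (Sh (rat^o)%R) 1%R.
Proof.
apply: dense_open_one_dimensional; first exact: rat_clopen_point.
have o0 : open (~` [set (0 : (rat^o)%R)])%classic.
  by apply: closed_openC; exact: closed_eq.
exists (Opens o0); split; first exact: dense_set1C.
by move/seteqP => -[_ /(_ 0 I)]; apply.
Qed.
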